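(* Let $n\ge 1$, let $F$ be a field that has at least $n-2$ elements and let $A\in M_n(F)$. Then $A$ is similar to $g(C_f)$ for suitable polynomials $f,g\in F[X]$, with $f$ monic of degree $n$.
   Context: For monic $f=f_0+f_1X+\cdots+f_{n-1}X^{n-1}+X^n\in F[X]$ the companion matrix $C_f\in M_n(F)$ has $1$'s on the first subdiagonal, last column $(-f_0,\dots,-f_{n-1})^T$, and $0$'s elsewhere. *)

(* Defs.v *)
From mathcomp Require Import all_boot all_order all_algebra.

Set Implicit Arguments.
Unset Strict Implicit.
Unset Printing Implicit Defensive.

Import GRing.Theory.
Local Open Scope ring_scope.

(* [T] may be infinite, so its cardinality is not available as [#|T|]. *)
Definition at_least_elements (k : nat) (T : eqType) : Prop :=
  exists2 s : seq T, uniq s & (k <= size s)%N.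

(* Meaningful for [f] monic of degree [n]. The library's [companionmx f] has
   the opposite (row) convention and its dimension is [(size f).-1], which does
   not fit 'M_n without a cast; [companionE] relates the two. *)
Definition companion (R : nzRingType) (n : nat) (f : {poly R}) : 'M[R]_n :=
  \matrix_(i < n, j < n)
    if j == n.-1 :> nat then - f`_i else (i == j.+1 :> nat)%:R.

Lemma companionE (R : nzRingType) (n : nat) (f : {poly R})
    (fn : (size f).-1 = n) :
  companion n f = castmx (fn, fn) (companionmx f)^T.
Proof.
by case: n / fn; apply/matrixP => i j; rewrite castmx_id !mxE [i == _ :> nat]eq_sym.
Qed.

(* Main.v *)
Require Import Defs.
From HB Require Import structures.
From mathcomp Require Import all_boot all_order all_algebra.
From mathcomp Require Import ring zify.
From Stdlib Require Import Classical.

(** A matrix is similar to [g(C_f)] exactly when the endomorphism it defines is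
    isomorphic to multiplication by [g] on [F[Y]/(f)]. So the basic objects are
    the blocks [(h, g)], standing for multiplication by [g] on [F[Y]/(h)], and
    the task is to turn a direct sum of blocks into a single one.

    Every matrix is a direct sum of blocks [(p^e, X)] with [p] irreducible
    ([primary_decomposition]). Two moves act on the blocks. Blocks with coprime
    [h] merge by the Chinese remainder theorem ([bsim_crt]), and [(h, g)] may be
    replaced by [(h(X - c), g(X - c))] for any scalar [c] ([bsim_shift]).
    Hence it suffices to choose shifts making the irreducible polynomials
    distinct. An irreducible polynomial of degree [d] already present rules out
    at most [d] shifts of another one of degree [d], so choosing shifts one by
    one succeeds when, for each [d], the number [k_d] of blocks of degree
    [d] satisfies [d (k_d - 1) < q], where [q] scalars are at hand
    ([bsim_greedy]).

    Let [N <= q + 2] be the size of the matrix. As [d k_d <= N], the condition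
    can only fail in three situations.
    - [d = 1], all blocks linear with [e = 1]: the matrix is diagonalizable.
    - [d = 1], one block [((X - c)^2, X)] and otherwise linear blocks with
      [e = 1].
    - [d = 2], all blocks quadratic with [e = 1], and [N = q + 2].

    If all blocks are [(p, X)] with [p] separable, then [b] copies of [(p, X)]
    form one block [(p^b, g)], where [g] is a root of [p] modulo [p^b] congruent
    to [X] modulo [p], found by Newton's iteration; no shift is needed
    ([bsim_semisimple]). This settles the first case, and the third one unless
    some quadratic [p] is inseparable. Then [p = X^2 + b] in characteristic 2,
    with [b] not a square. Squaring is then injective but not surjective on [F],
    so there is a scalar beyond the [q] given ones, and with it the greedy choice
    works after all ([inseparable_quadratic]). In the second case, either
    [X - c] does not occur among the other blocks, and the semisimple
    construction applies to these; or it does, and then [((X - c)^2, X)] and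
    [(X - c, X)] together form the block [(Z^3, c + Z^2)] with [Z = X - c]
    ([bsim_jordan21]), which lowers the number of linear blocks to [N - 2 <= q].

    Since matrices act here on row vectors, all this is applied to the transpose
    of the given matrix. *)

Set Implicit Arguments.
Unset Strict Implicit.
Unset Printing Implicit Defensive.

Import GRing.Theory.
Local Open Scope ring_scope.

Section Blocks.

Variable F : fieldType.
Implicit Types (p q r f g h : {poly F}).

(** * Similarity across dimensions *)

(** Similarity of square matrices whose dimensions are equal only
    propositionally: the change of basis is a rectangular matrix with a
    two-sided inverse, so no cast is needed. *)
Definition hsim n m (A : 'M[F]_n) (B : 'M[F]_m) :=
  exists P : 'M_(n, m), exists Q : 'M_(m, n),
    [/\ P *m Q = 1%:M, Q *m P = 1%:M & A *m P = P *m B].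

Lemma hsim_refl n (A : 'M_n) : hsim A A.
Proof. by exists 1%:M, 1%:M; rewrite !mulmx1 mul1mx. Qed.

Lemma hsim_sym n m (A : 'M_n) (B : 'M_m) : hsim A B -> hsim B A.
Proof.
move=> [P [Q [PQ QP AP]]]; exists Q, P; split=> //.
have -> : B *m Q = Q *m (P *m B) *m Q by rewrite !mulmxA QP mul1mx.
by rewrite -AP -!mulmxA PQ mulmx1.
Qed.

Lemma hsim_trans n m k (A : 'M_n) (B : 'M_m) (C : 'M_k) :
  hsim A B -> hsim B C -> hsim A C.
Proof.
move=> [P [Q [PQ QP AP]]] [R [S [RS SR BR]]].
exists (P *m R), (S *m Q); split.
- by rewrite mulmxA -(mulmxA P) RS mulmx1.
- by rewrite mulmxA -(mulmxA S) QP mulmx1.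
- by rewrite mulmxA AP -!mulmxA BR.
Qed.

Lemma hsim_dim n m (A : 'M_n) (B : 'M_m) : hsim A B -> n = m.
Proof.
move=> [P [Q [PQ QP _]]]; apply/eqP; rewrite eqn_leq.
by rewrite (mulmx1_min PQ) (mulmx1_min QP).
Qed.

Lemma hsim_dim0 n m (A : 'M[F]_n) (B : 'M[F]_m) : n = 0 -> m = 0 -> hsim A B.
Proof.
by move=> n0 m0; subst n m; rewrite [A]flatmx0 [B]flatmx0; apply: hsim_refl.
Qed.

Lemma hsim_unit n (A B P : 'M_n) :
  P \in unitmx -> A *m P = P *m B -> hsim A B.
Proof. by move=> uP eP; exists P, (invmx P); rewrite mulmxV ?mulVmx. Qed.

Lemma hsim_rect n m (A : 'M[F]_n) (B : 'M[F]_m) (T : 'M_(m, n)) :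
  m = n -> row_free T -> B *m T = T *m A -> hsim B A.
Proof.
move=> mn; case: n / mn in A T *; rewrite row_free_unit => uT eT.
exact: (hsim_unit uT).
Qed.

Lemma hsim_block n1 n2 m1 m2 (A1 : 'M_n1) (A2 : 'M_n2) (B1 : 'M_m1)
    (B2 : 'M_m2) :
  hsim A1 B1 -> hsim A2 B2 -> hsim (block_mx A1 0 0 A2) (block_mx B1 0 0 B2).
Proof.
move=> [P [Q [PQ QP AP]]] [R [S [RS SR BR]]].
exists (block_mx P 0 0 R), (block_mx Q 0 0 S).
by rewrite !mulmx_block !(mul0mx, mulmx0, addr0, add0r) PQ QP RS SR AP BR
   -!scalar_mx_block.
Qed.

(** Exchange of the first two summands of a threefold block sum. *)
Lemma hsim_blockAC n1 n2 n3 (A : 'M_n1) (B : 'M_n2) (C : 'M_n3) :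
  hsim (block_mx A 0 0 (block_mx B 0 0 C)) (block_mx B 0 0 (block_mx A 0 0 C)).
Proof.
pose P m k l : 'M[F]_(m + (k + l), k + (m + l)) :=
  col_mx (row_mx 0 (row_mx 1%:M 0))
    (col_mx (row_mx 1%:M 0) (row_mx 0 (row_mx 0 1%:M))).
have PK m k l : P m k l *m P k m l = 1%:M.
  rewrite !(mul_col_mx, mul_row_col, mul_mx_row, mul0mx, mulmx0, mul1mx,
    mulmx1, add0r, addr0, row_mx0).
  rewrite [RHS]scalar_mx_block [X in block_mx _ _ _ X]scalar_mx_block.
  rewrite /block_mx; congr col_mx.
  by rewrite -[LHS]/(block_mx 0 _ 0 _) block_mxEh col_mx0.
exists (P n1 n2 n3), (P n2 n1 n3); split=> //.
by rewrite /block_mx !(mul_col_mx, mul_row_col, mul_mx_row, mul0mx, mulmx0,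
  mul1mx, mulmx1, add0r, addr0, row_mx0).
Qed.

Lemma hsim_blockA n1 n2 n3 (A : 'M_n1) (B : 'M_n2) (C : 'M_n3) :
  hsim (block_mx A 0 0 (block_mx B 0 0 C)) (block_mx (block_mx A 0 0 B) 0 0 C).
Proof.
exists (col_mx (row_mx (row_mx 1%:M 0) 0)
  (col_mx (row_mx (row_mx 0 1%:M) 0) (row_mx 0 1%:M))).
exists (col_mx (col_mx (row_mx 1%:M 0) (row_mx 0 (row_mx 1%:M 0)))
  (row_mx 0 (row_mx 0 1%:M))).
split.
- rewrite !(mul_col_mx, mul_row_col, mul_mx_row, mul0mx, mulmx0, mul1mx,
    mulmx1, add0r, addr0, row_mx0).
  rewrite [RHS]scalar_mx_block [X in block_mx _ _ _ X]scalar_mx_block.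
  rewrite {1}/block_mx; congr col_mx.
  by rewrite -[LHS]/(block_mx 0 _ 0 _) block_mxEh col_mx0.
- rewrite !(mul_col_mx, mul_row_col, mul_mx_row, mul0mx, mulmx0, mul1mx,
    mulmx1, add0r, addr0, row_mx0).
  rewrite [RHS]scalar_mx_block [X in block_mx X _ _ _]scalar_mx_block.
  rewrite /block_mx; congr col_mx.
  by rewrite -[LHS]/(block_mx _ 0 _ 0) block_mxEh col_mx0.
by rewrite /block_mx !(mul_col_mx, mul_row_col, mul_mx_row, mul0mx, mulmx0,
  mul1mx, mulmx1, add0r, addr0, row_mx0).
Qed.

(** A summand of dimension 0 can be dropped. *)
Lemma hsim_block0 n (A : 'M_n) (B : 'M_0) : hsim A (block_mx A 0 0 B).
Proof.
exists (row_mx 1%:M 0), (col_mx 1%:M 0); split.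
- by rewrite mul_row_col mulmx1 mul0mx addr0.
- rewrite mul_col_row !(mulmx1, mul1mx, mulmx0, mul0mx).
  by rewrite [RHS]scalar_mx_block; congr block_mx; apply/matrixP => -[].
- rewrite mul_mx_row mul_row_block !(mulmx1, mul1mx, mulmx0, mul0mx).
  by rewrite !addr0.
Qed.

(** * Polynomial arithmetic *)

Lemma size_predK h : h != 0 -> size h = (size h).-1.+1.
Proof. by rewrite -size_poly_gt0 => /prednK. Qed.

Lemma size_mul_pred h1 h2 : h1 != 0 -> h2 != 0 ->
  (size (h1 * h2)%R).-1 = ((size h1).-1 + (size h2).-1)%N.
Proof.
move=> h10 h20; rewrite size_mul //.
by case: (size h1) (size h2) (size_poly_gt0 h1) (size_poly_gt0 h2)
  => [|a] [|b]; rewrite ?h10 ?h20 // addSn addnS.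
Qed.

(** A representative of degree below [deg h] is determined by its class modulo
    [h]. *)
Lemma small_dvdp0 h p : (size p <= (size h).-1)%N -> h != 0 -> h %| p -> p = 0.
Proof.
move=> sp h0; case: (eqVneq p 0) => // p0 /(dvdp_leq p0).
by rewrite leqNgt (size_predK h0) ltnS sp.
Qed.

Lemma dvdp_modpB p q r : q %| p %% q - r = (q %| p - r).
Proof.
by rewrite [in RHS](divp_eq p q) -addrA [RHS]dvdp_addr ?dvdp_mulIr.
Qed.

Lemma linear_mulr r : linear (fun p => p * r).
Proof. by move=> a x y; rewrite mulrDl -scalerAl. Qed.

Lemma linear_comp r : linear (fun p => p \Po r).
Proof. by move=> a x y; rewrite comp_polyD comp_polyZ. Qed.

Lemma coprimep_bezout p q : coprimep p q -> exists u v, u * p + v * q = 1.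
Proof.
move=> /Bezout_coprimepP[[u v] /=]; rewrite eqp_sym.
move=> /eqpP[[a b] /= /andP[a0 b0] e].
exists (a^-1 * b *: u), (a^-1 * b *: v).
by rewrite -!scalerAl -scalerDr -scalerA -e scalerA mulVf // scale1r.
Qed.

Lemma chinese_poly p q a b : coprimep p q ->
  exists g, (p %| g - a) /\ (q %| g - b).
Proof.
move=> /coprimep_bezout[u [v e]]; exists (a * (v * q) + b * (u * p)).
have e1 : v * q = 1 - u * p by rewrite -e addrC addKr.
split.
  have -> : a * (v * q) + b * (u * p) - a = (b - a) * u * p by rewrite e1; ring.
  exact: dvdp_mull.
have -> : a * (v * q) + b * (u * p) - b = (a - b) * v * q.
  by rewrite -[in LHS](addrK (v * q) (u * p)) e; ring.
exact: dvdp_mull.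
Qed.

Lemma dvdp_compB (u a b : {poly F}) : a - b %| (u \Po a) - (u \Po b).
Proof.
elim/poly_ind: u => [|u c IH]; first by rewrite !comp_poly0 subrr dvdp0.
rewrite !comp_poly_MXaddC opprD addrACA subrr addr0.
have -> : (u \Po a) * a - (u \Po b) * b =
  ((u \Po a) - (u \Po b)) * a + (u \Po b) * (a - b) by ring.
by apply: dvdp_add; [apply: dvdp_mulr | apply: dvdp_mulIr].
Qed.

(** Taylor's formula to first order, [p(g + d) = p(g) + d p'(g)] modulo
    [d^2]. *)
Lemma taylor2 p (g d : {poly F}) :
  d ^+ 2 %| (p \Po (g + d)) - ((p \Po g) + d * (p^`() \Po g)).
Proof.
elim/poly_ind: p => [|p c IH].
  by rewrite deriv0 !comp_poly0 mulr0 addr0 subrr dvdp0.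
rewrite derivMXaddC !comp_poly_MXaddC comp_polyD comp_polyM comp_polyX.
set a := p \Po (g + d) in IH *; set b := p \Po g in IH *.
set b' := p^`() \Po g in IH *.
have -> : a * (g + d) + c%:P - (b * g + c%:P + d * (b + b' * g)) =
  (a - (b + d * b')) * (g + d) + b' * d ^+ 2 by ring.
by apply: dvdp_add; [apply: dvdp_mulr | apply: dvdp_mulIr].
Qed.

(** A separable [p] has a root modulo [p^b] that is congruent to [X] modulo [p],
    by Newton's iteration starting from [X], which is a root modulo [p]. *)
Lemma newton_root p b : coprimep p p^`() ->
  exists g, p %| g - 'X /\ p ^+ b %| p \Po g.
Proof.
move=> /coprimep_bezout[v [u uv]].
(* Each step squares the modulus, so the powers [2^b] are reached. *)
suff [g [gX pg]] : exists g, p %| g - 'X /\ p ^+ (2 ^ b) %| p \Po g.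
  exists g; split=> //; apply: dvdp_trans pg; apply: dvdp_exp2l.
  exact/ltnW/ltn_expl.
elim: b => [|b [g [gX pg]]].
  by exists 'X; rewrite subrr dvdp0 comp_polyXr expr1 dvdpp.
pose P := p \Po g; pose d := - (P * (u \Po g)).
have pP : p %| P.
  by apply: dvdp_trans pg; rewrite -{1}[p]expr1 dvdp_exp2l ?expn_gt0.
exists (g + d); split.
  by rewrite addrAC dvdp_add // dvdpNr dvdp_mulr.
apply: (@dvdp_trans _ (P ^+ 2)); first by rewrite expnSr exprM dvdp_exp2r.
rewrite -(subrK (P + d * (p^`() \Po g)) (p \Po _)); apply: dvdp_add.
  by apply: dvdp_trans (taylor2 _ _ _); rewrite dvdp_exp2r // dvdpNr dvdp_mulr.
have -> : P + d * (p^`() \Po g) = P * (1 - (u * p^`() \Po g)).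
  by rewrite /d comp_polyM; ring.
have -> : 1 - (u * p^`() \Po g) = v * p \Po g.
  have e1 : (1 : {poly F}) \Po g = 1 by rewrite -polyC1 comp_polyC.
  by rewrite -[X in X - _]e1 -comp_polyB -uv addrK.
by rewrite comp_polyM mulrCA expr2 dvdp_mulIr.
Qed.

Lemma exists_irreducible_factor q : (1 < size q)%N ->
  exists p, [/\ p \is monic, irreducible_poly p & p %| q].
Proof.
have [n] := ubnP (size q); elim: n q => // n IH q /ltnSE sq s1.
have q0 : q != 0 by rewrite -size_poly_gt0 ltnW.
case: (classic (irreducible_poly q)) => [irr | nirr].
  exists ((lead_coef q)^-1 *: q); split.
  - by rewrite monicE lead_coefZ mulVf // lead_coef_eq0.
  - have l0 : (lead_coef q)^-1 != 0 by rewrite invr_eq0 lead_coef_eq0.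
    split=> [|d sd]; first by rewrite size_scale.
    rewrite dvdpZr // => /(irr.2 _ sd) /eqp_trans -> //.
    by rewrite eqp_sym eqp_scale.
  - by rewrite dvdpZl ?dvdpp // invr_eq0 lead_coef_eq0.
have [|nd] := classic (exists d : {poly F},
  [/\ size d != 1%N, d %| q & ~~ (d %= q)]); last first.
  case: nirr; split=> // d sd dq; apply: contraT => ndq.
  by case: nd; exists d.
move=> [d [sd dq ndq]].
have d0 : d != 0 by apply: contraNneq q0 => d0; rewrite -dvd0p -d0.
have sdq : (size d < size q)%N.
  by rewrite ltn_neqAle dvdp_leq // andbT dvdp_size_eqp.
have [||p [pm pirr pd]] := IH d; first exact: leq_trans sdq sq.
  by move: sd (d0); rewrite -size_poly_gt0; case: (size d) => [|[]].
by exists p; split=> //; apply: dvdp_trans dq.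
Qed.

(** The [p]-part of [q] split off. *)
Lemma factor_out p q : (1 < size p)%N -> q != 0 ->
  exists e r, q = p ^+ e * r /\ ~~ (p %| r).
Proof.
move=> sp; have [n] := ubnP (size q); elim: n q => // n IH q /ltnSE sq q0.
have [/dvdpP [r eq_q] | ndv] := boolP (p %| q); last first.
  by exists 0%N, q; rewrite expr0 mul1r.
have r0 : r != 0 by apply: contraNneq q0 => r0; rewrite eq_q r0 mul0r.
have p0 : p != 0 by rewrite -size_poly_gt0 ltnW.
have [|e [s [er ps]]] := IH r _ r0.
  apply: leq_trans sq; rewrite eq_q size_mul //.
  by case: (size p) sp => [|[|k]] // _; rewrite addnS /= addnS ltnS leq_addr.
by exists e.+1, s; rewrite eq_q er exprSr mulrAC.
Qed.

Lemma irredp_coprime p q : irreducible_poly p -> ~~ (p %| q) -> coprimep p q.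
Proof.
move=> irr npq; rewrite /coprimep; apply: contraT => sg.
have := irr.2 _ sg (dvdp_gcdl p q) => /eqp_dvdl e.
by case/negP: npq; rewrite -e dvdp_gcdr.
Qed.

Lemma irredp_neq_coprime p q : p \is monic -> irreducible_poly p ->
  q \is monic -> irreducible_poly q -> p != q -> coprimep p q.
Proof.
move=> pm pirr qm qirr npq; apply: irredp_coprime => //.
apply: contra npq => pq; rewrite -eqp_monic //; apply: qirr.2 => //.
by rewrite gtn_eqF // pirr.1.
Qed.

(** The ring [F[X]/(p^(e+1))] has a simple socle, generated by [p^e]: every
    nonzero element [u] has [p^e] among its multiples. *)
Lemma socle_primary p e (u : {poly F}) : irreducible_poly p ->
    u != 0 -> ~~ (p ^+ e.+1 %| u) ->
  exists s, p ^+ e.+1 %| u * s - p ^+ e.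
Proof.
move=> irr u0 ndv.
have [k [w [eu pw]]] := factor_out irr.1 u0.
have ke : (k <= e)%N.
  rewrite leqNgt; apply: contra ndv => /(dvdp_exp2l p) ek.
  by rewrite eu; apply: dvdp_mulr.
have /coprimep_bezout[a [b ab]] : coprimep w (p ^+ e.+1).
  by rewrite coprimep_sym; apply/coprimep_expl/irredp_coprime.
exists (a * p ^+ (e - k)).
have -> : u * (a * p ^+ (e - k)) - p ^+ e = - (p ^+ e * b) * p ^+ e.+1.
  have -> : u * (a * p ^+ (e - k)) = a * w * p ^+ e.
    by rewrite eu -[in RHS](subnKC ke) exprD; ring.
  by rewrite -[a * w](addrK (b * p ^+ e.+1)) ab; ring.
exact: dvdp_mulIr.
Qed.

Lemma irredp_shift p c :
  irreducible_poly p -> irreducible_poly (p \Po ('X - c%:P)).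
Proof.
move=> [sp irr].
have X2 : size ('X - c%:P : {poly F}) = 2%N by rewrite size_XsubC.
have X2' : size ('X + c%:P : {poly F}) = 2%N by rewrite size_XaddC.
have KC (q : {poly F}) : (q \Po ('X + c%:P)) \Po ('X - c%:P) = q.
  by rewrite comp_polyXaddC_K.
have CK (q : {poly F}) : (q \Po ('X - c%:P)) \Po ('X + c%:P) = q.
  by rewrite -{2}[c]opprK polyCN opprK -{1}[c]opprK polyCN comp_polyXaddC_K.
split=> [|d sd /(dvdp_comp_poly ('X + c%:P))]; first by rewrite size_comp_poly2.
rewrite CK => /irr; rewrite size_comp_poly2 // => /(_ sd) /andP[d1 d2].
by rewrite -[d]KC; apply/andP; split; apply: dvdp_comp_poly.
Qed.

Lemma monic_shift p c : p \is monic -> p \Po ('X - c%:P) \is monic.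
Proof.
move=> pm; rewrite monicE lead_coef_comp ?size_XsubC //.
by rewrite lead_coefXsubC expr1n mulr1 (monicP pm).
Qed.

(** A shift carrying [p] to a polynomial [r] of the same degree [d] is a root of
    [p(-X) - r(0)], so each such [r] excludes at most [d] shifts. *)
Lemma exists_shift (s : seq F) p (ps : seq {poly F}) : (1 < size p)%N ->
    uniq s -> ((size p).-1 * count (fun r => size r == size p) ps < size s)%N ->
  exists c, p \Po ('X - c%:P) \notin ps.
Proof.
move=> sp us lt_s.
pose ex r : {poly F} := (p \Po (- 'X)) - (r.[0])%:P.
have sN : size (- 'X : {poly F}) = 2%N by rewrite size_polyN size_polyX.
have sex r : size (ex r) = size p.
  rewrite /ex size_polyDl size_comp_poly2 // size_polyN size_polyC.
  by apply: leq_ltn_trans sp; case: eqP.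
have ex0 r : ex r != 0 by rewrite -size_poly_gt0 sex ltnW.
pose R := \prod_(r <- ps | size r == size p) ex r.
have R0 : R != 0.
  by rewrite prodf_seq_neq0; apply/allP => r _; rewrite ex0 implybT.
have sR : (size R <= ((size p).-1 * count (fun r => size r == size p) ps).+1)%N.
  rewrite /R; elim: {R R0 lt_s} ps => [|r ps IH].
    by rewrite big_nil size_poly1.
  rewrite big_cons /=; case: ifP => _; last by rewrite add0n.
  rewrite (leq_trans (size_polyMleq _ _)) // sex.
  rewrite mulnDr muln1 -addnS.
  have aux P a b : (1 < P)%N -> (a <= b.+1)%N -> ((P + a).-1 <= P.-1 + b.+1)%N.
    by lia.
  exact: aux.
have /allPn[c cs ncR] : ~~ all (root R) s.
  apply/negP => /(max_poly_roots R0) /(_ us) /leq_trans /(_ sR).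
  by rewrite ltnS leqNgt lt_s.
exists c; apply: contra ncR => cps.
rewrite /R (big_rem _ cps) /= size_comp_poly2 ?size_XsubC // eqxx rootM.
rewrite /root /ex !(hornerD, hornerN, hornerC, horner_comp, hornerX).
by rewrite sub0r subrr eqxx.
Qed.

Lemma size2_monicE p : p \is monic -> size p = 2%N -> exists c, p = 'X - c%:P.
Proof.
move=> pm sp; exists (- p`_0); apply/polyP => i.
rewrite polyCN opprK coefD coefX coefC.
case: i => [|[|i]] /=; rewrite ?add0r ?addr0 //.
  by rewrite -(monicP pm) /lead_coef sp.
by rewrite nth_default // sp.
Qed.

Lemma size2_separable p : p \is monic -> size p = 2%N -> coprimep p p^`().
Proof. by move=> pm /(size2_monicE pm)[c ->]; rewrite derivXsubC coprimep1. Qed.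

(** An inseparable irreducible quadratic polynomial is [X^2 + b] in
    characteristic 2, with [b] not a square; squaring being injective, no finite
    list of scalars can then exhaust the field. *)
Lemma inseparable_quadratic p (s : seq F) : p \is monic -> irreducible_poly p ->
  size p = 3%N -> ~~ coprimep p p^`() -> uniq s -> exists x, x \notin s.
Proof.
move=> pm pirr sp ncop us.
have p'0 : p^`() = 0.
  have pp' : p %| p^`() by apply: contraNT ncop => /irredp_coprime ->.
  apply: small_dvdp0 pp'; last exact: monic_neq0.
  by rewrite -ltnS -size_predK ?monic_neq0 // lt_size_deriv // monic_neq0.
have p2 : p`_2 = 1 by rewrite -(monicP pm) /lead_coef sp.
have p1 : p`_1 = 0.
  have := congr1 (fun q : {poly F} => q`_0) p'0.
  by rewrite coef_deriv coef0 mulr1n.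
have two0 : 2%:R = 0 :> F.
  by have := congr1 (fun q : {poly F} => q`_1) p'0; rewrite coef_deriv coef0 p2.
have nsq y : y ^+ 2 != p`_0.
  apply/negP => /eqP yp.
  have py : root p y.
    rewrite /root horner_coef sp !big_ord_recl big_ord0 /= p1 p2 /bump /= -yp.
    rewrite expr0 mulr1 mul0r mul1r addr0 add0r -mulr2n -mulr_natl.
    by rewrite two0 mul0r.
  have := dvdp_XsubCl p y; rewrite py => /(pirr.2 _ _).
  by rewrite size_XsubC => /(_ isT) /eqp_size; rewrite size_XsubC sp.
have sq_inj : injective (fun y : F => y ^+ 2).
  move=> x y /eqP; rewrite -subr_eq0 subr_sqr mulf_eq0.
  have -> : x + y = x - y.
    have -> : x + y = (x - y) + 2%:R * y by ring.
    by rewrite two0 mul0r addr0.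
  by rewrite orbb subr_eq0 => /eqP.
have [bs | ] := boolP (p`_0 \in s); last by exists p`_0.
have /allPn[x /mapP[y ys ->] nx] : ~~ all (mem s) [seq y ^+ 2 | y <- s].
  apply/negP => /allP sub.
  have /uniq_leq_size : uniq (p`_0 :: [seq y ^+ 2 | y <- s]).
    rewrite /= map_inj_uniq // us andbT; apply/mapP => -[y _ e].
    by move: (nsq y); rewrite e eqxx.
  move=> /(_ s); rewrite /= size_map ltnn => H; suff: false by [].
  by apply: H => x; rewrite inE => /predU1P[-> // | /sub].
by exists (y ^+ 2).
Qed.

(** * Multiplication operators on quotients *)

(** [mul_rV_lin1] for a function whose linearity is a hypothesis rather than a
    structure. *)
Lemma mul_rV_lin1_prop m n (f : 'rV[F]_m -> 'rV[F]_n) (u : 'rV_m) :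
  linear f -> u *m lin1_mx f = f u.
Proof.
move=> fL.
pose fM := GRing.isLinear.Build _ _ _ _ f fL.
pose fl : {linear 'rV[F]_m -> 'rV[F]_n} := HB.pack f fM.
exact: (mul_rV_lin1 fl u).
Qed.

(** Multiplication by [g] on [F[Y]/(h)], acting on row vectors of coefficients
    in the basis [1, Y, ..., Y^(d-1)]. It has this meaning when [d = deg h]; the
    dimension is a separate argument to avoid casts. *)
Definition mulmod_mx d h g : 'M[F]_d :=
  lin1_mx (fun u : 'rV_d => poly_rV (rVpoly u * g %% h)).

Lemma mul_mulmod d h g (u : 'rV_d) :
  u *m mulmod_mx d h g = poly_rV (rVpoly u * g %% h).
Proof.
apply: mul_rV_lin1_prop => a x y.
by rewrite linearP mulrDl -scalerAl modpD modpZl linearP.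
Qed.

Lemma poly_rV_inj_size d (p q : {poly F}) :
  (size p <= d)%N -> (size q <= d)%N ->
  poly_rV p = poly_rV q :> 'rV_d -> p = q.
Proof. by move=> sp sq /(congr1 rVpoly); rewrite !poly_rV_K. Qed.

(** A linear map [th] to [F[Y]/(h)], injective between spaces of the same
    dimension and carrying [B] to multiplication by [g], is a similarity. *)
Lemma mulmod_iso m d (B : 'M[F]_m) h g (th : 'rV_m -> {poly F}) :
    m = d -> size h = d.+1 -> linear th ->
    (forall u, h %| th (u *m B) - th u * g) ->
    (forall u, h %| th u -> u = 0) ->
  hsim B (mulmod_mx d h g).
Proof.
move=> md; case: d / md => hs thL thB th0.
have h0 : h != 0 by rewrite -size_poly_gt0 hs.
have smod q : (size (q %% h)%R <= m)%N by rewrite -ltnS -hs ltn_modp.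
pose P : 'M_m := lin1_mx (fun u => poly_rV (th u %% h)).
have PE (u : 'rV_m) : u *m P = poly_rV (th u %% h).
  apply: (mul_rV_lin1_prop u (f := fun u => poly_rV (th u %% h))).
  by move=> a x y; rewrite thL modpD modpZl linearP.
apply: (@hsim_unit _ _ _ P).
  rewrite -row_free_unit; apply: inj_row_free => u; rewrite PE => e.
  apply/th0/modp_eq0P/(poly_rV_inj_size (smod _)); rewrite ?size_poly0 //.
  by rewrite e linear0.
apply/row_matrixP => i; rewrite !row_mul !rowE !PE mul_mulmod poly_rV_K //.
congr poly_rV; rewrite [X in _ = X %% h]mulrC modp_mul [X in _ = X %% h]mulrC.
by apply/eqP; rewrite -subr_eq0 -modpN -modpD; apply/eqP/modp_eq0.
Qed.

(** The same with a direct sum of two quotients as source; the maps [th1] and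
    [th2] are given on representatives. *)
Lemma mulmod_block d1 d2 h1 h2 h g1 g2 g (th1 th2 : {poly F} -> {poly F}) :
    size h = (d1 + d2).+1 -> size h1 = d1.+1 -> size h2 = d2.+1 ->
    linear th1 -> linear th2 ->
    (forall u : {poly F}, (size u <= d1)%N ->
       h %| th1 (u * g1 %% h1) - th1 u * g) ->
    (forall u : {poly F}, (size u <= d2)%N ->
       h %| th2 (u * g2 %% h2) - th2 u * g) ->
    (forall u w : {poly F}, (size u <= d1)%N -> (size w <= d2)%N ->
       h %| th1 u + th2 w -> u = 0 /\ w = 0) ->
  hsim (block_mx (mulmod_mx d1 h1 g1) 0 0 (mulmod_mx d2 h2 g2))
    (mulmod_mx (d1 + d2) h g).
Proof.
move=> hs hs1 hs2 L1 L2 H1 H2 inj.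
have smod d (k q : {poly F}) : size k = d.+1 -> (size (q %% k)%R <= d)%N.
  by move=> sk; rewrite -ltnS -sk ltn_modp -size_poly_gt0 sk.
pose th (u : 'rV_(d1 + d2)) :=
  th1 (rVpoly (lsubmx u)) + th2 (rVpoly (rsubmx u)).
apply: (@mulmod_iso _ _ _ _ _ th) => //.
- by move=> a x y; rewrite /th !linearP L1 L2 scalerDr addrACA.
- move=> u; rewrite /th -[u in u *m _]hsubmxK mul_row_block !mulmx0 addr0 add0r.
  rewrite row_mxKl row_mxKr !mul_mulmod !poly_rV_K ?smod //.
  rewrite mulrDl opprD addrACA.
  by apply: dvdp_add; [apply: H1 | apply: H2]; rewrite size_poly.
move=> u /inj[]; rewrite ?size_poly // => u1 u2.
rewrite -[u]hsubmxK -[lsubmx u]rVpolyK -[rsubmx u]rVpolyK u1 u2 !linear0.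
exact: row_mx0.
Qed.

Lemma mulmod_congr d h g g' : h %| g - g' -> mulmod_mx d h g = mulmod_mx d h g'.
Proof.
move=> hg; apply/row_matrixP => i; rewrite !rowE !mul_mulmod; congr poly_rV.
apply/eqP; rewrite -subr_eq0 -modpN -modpD -mulrBr.
exact/eqP/modp_eq0/dvdp_mull.
Qed.

(** * Direct sums of blocks *)

(** The dimension of the direct sum of the [F[Y]/(h)], for [(h, g)] in [L]. *)
Fixpoint blocks_dim (L : seq ({poly F} * {poly F})) : nat :=
  if L is b :: L' then ((size b.1).-1 + blocks_dim L')%N else 0%N.

(** The block diagonal matrix of the operators [g] on [F[Y]/(h)], for [(h, g)]
    in [L]. *)
Fixpoint blocks_mx (L : seq ({poly F} * {poly F})) : 'M[F]_(blocks_dim L) :=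
  if L is b :: L' then
    block_mx (mulmod_mx (size b.1).-1 b.1 b.2) 0 0 (blocks_mx L')
  else 0.

(** Two lists of blocks define similar matrices. *)
Definition bsim L1 L2 := hsim (blocks_mx L1) (blocks_mx L2).

Lemma bsim_refl L : bsim L L.
Proof. exact: hsim_refl. Qed.

Lemma bsim_trans L1 L2 L3 : bsim L1 L2 -> bsim L2 L3 -> bsim L1 L3.
Proof. exact: hsim_trans. Qed.

Lemma bsim_nil : bsim [::] [:: (1, 0 : {poly F})].
Proof. by apply: hsim_dim0 => //=; rewrite size_poly1. Qed.

Lemma blocks_mx1 (b : {poly F} * {poly F}) :
  hsim (blocks_mx [:: b]) (mulmod_mx (size b.1).-1 b.1 b.2).
Proof. exact/hsim_sym/hsim_block0. Qed.

Lemma bsim_cons b L1 L2 : bsim L1 L2 -> bsim (b :: L1) (b :: L2).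
Proof. exact/hsim_block/hsim_refl. Qed.

Lemma bsim_cons1 (b1 b2 : {poly F} * {poly F}) L :
  hsim (mulmod_mx (size b1.1).-1 b1.1 b1.2)
    (mulmod_mx (size b2.1).-1 b2.1 b2.2) ->
  bsim (b1 :: L) (b2 :: L).
Proof. by move=> h; apply: hsim_block (hsim_refl _). Qed.

Lemma bsim_cons2 (b b1 b2 : {poly F} * {poly F}) L :
  hsim (block_mx (mulmod_mx (size b1.1).-1 b1.1 b1.2) 0 0
                 (mulmod_mx (size b2.1).-1 b2.1 b2.2))
    (mulmod_mx (size b.1).-1 b.1 b.2) ->
  bsim (b1 :: b2 :: L) (b :: L).
Proof.
move=> h; apply: hsim_trans (hsim_blockA _ _ _) _.
exact: hsim_block (hsim_refl _).
Qed.

Lemma bsim_swap b1 b2 L : bsim (b1 :: b2 :: L) (b2 :: b1 :: L).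
Proof. exact: hsim_blockAC. Qed.

Lemma bsim_move b L1 L2 : bsim (b :: L1 ++ L2) (L1 ++ b :: L2).
Proof.
elim: L1 => [|a L1 IH] /=; first exact: bsim_refl.
exact: bsim_trans (bsim_swap _ _ _) (bsim_cons a IH).
Qed.

Lemma bsim_perm L1 L2 : perm_eq L1 L2 -> bsim L1 L2.
Proof.
elim: L1 L2 => [|b L1 IH] L2 pL.
  by move: pL; rewrite perm_sym => /perm_nilP ->; apply: bsim_refl.
have bL2 : b \in L2 by rewrite -(perm_mem pL) mem_head.
case/path.splitPr: bL2 pL => s1 s2 pL.
apply: bsim_trans (bsim_move _ _ _); apply/bsim_cons/IH.
rewrite -(perm_cons b) (perm_trans pL) //.
by rewrite -cat1s perm_catCA perm_refl.
Qed.

Lemma bsim_crt h1 h2 g1 g2 g L : h1 != 0 -> h2 != 0 -> coprimep h1 h2 ->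
  h1 %| g - g1 -> h2 %| g - g2 ->
  bsim ((h1, g1) :: (h2, g2) :: L) ((h1 * h2, g) :: L).
Proof.
move=> h10 h20 cop gg1 gg2; apply: bsim_cons2 => /=.
rewrite size_mul_pred //.
apply: (@mulmod_block _ _ _ _ _ _ _ _ (fun p => p * h2) (fun p => p * h1)).
- by rewrite -size_mul_pred // -size_predK // mulf_neq0.
- exact: size_predK.
- exact: size_predK.
- exact: linear_mulr.
- exact: linear_mulr.
- move=> u _; rewrite mulrAC -mulrBl dvdp_mul2r // dvdp_modpB -mulrBr.
  by rewrite dvdp_mull // -opprB dvdpNr.
- move=> u _; rewrite mulrAC -mulrBl mulrC dvdp_mul2r // dvdp_modpB -mulrBr.
  by rewrite dvdp_mull // -opprB dvdpNr.
move=> u w su sw dv.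
have [d1 d2] := (dvdp_trans (dvdp_mulr h2 (dvdpp h1)) dv,
  dvdp_trans (dvdp_mull h1 (dvdpp h2)) dv).
split; [apply: (small_dvdp0 su) | apply: (small_dvdp0 sw)] => //.
  by move: d1; rewrite dvdp_addl ?dvdp_mulIr // Gauss_dvdpl.
by move: d2; rewrite dvdp_addr ?dvdp_mulIr // Gauss_dvdpl // coprimep_sym.
Qed.

Lemma bsim_shift h g c L : h != 0 ->
  bsim ((h, g) :: L) ((h \Po ('X - c%:P), g \Po ('X - c%:P)) :: L).
Proof.
move=> h0; apply: bsim_cons1 => /=.
have X2 : size ('X - c%:P : {poly F}) = 2%N by rewrite size_XsubC.
apply: (@mulmod_iso _ _ _ _ _ (fun u => rVpoly u \Po ('X - c%:P))).
- by rewrite size_comp_poly2.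
- by rewrite -size_predK // comp_poly2_eq0.
- by move=> a x y; rewrite linearP comp_polyD comp_polyZ.
- move=> u; rewrite mul_mulmod poly_rV_K.
    rewrite -comp_polyM -comp_polyB; apply: dvdp_comp_poly.
    by rewrite dvdp_modpB subrr.
  by rewrite -ltnS -size_predK // ltn_modp.
move=> u /(dvdp_comp_poly ('X + c%:P)); rewrite -!comp_polyA.
rewrite comp_polyB comp_polyX comp_polyC addrK !comp_polyXr.
move=> dv; have e : rVpoly u = 0 := small_dvdp0 (size_poly _ _) h0 dv.
by rewrite -[u]rVpolyK e linear0.
Qed.

(** In [F[Y]/(p^(b+1))] the multiples of [p] form a copy of [F[Y]/(p^b)]; if [g]
    is a root of [p] there, the polynomials in [g] form a complementary copy of
    [F[X]/(p)]. *)
Lemma bsim_split p g b L : p != 0 -> p %| g - 'X -> p ^+ b.+1 %| p \Po g ->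
  bsim ((p, 'X) :: (p ^+ b, g) :: L) ((p ^+ b.+1, g) :: L).
Proof.
move=> p0 pg pbg; apply: bsim_cons2 => /=.
rewrite exprS size_mul_pred ?expf_neq0 //.
apply: (@mulmod_block _ _ _ _ _ _ _ _ (fun u => u \Po g) (fun u => u * p)).
- by rewrite -size_mul_pred ?expf_neq0 // -size_predK // mulf_neq0 ?expf_neq0.
- exact: size_predK.
- by apply: size_predK; rewrite expf_neq0.
- exact: linear_comp.
- exact: linear_mulr.
- move=> u _; rewrite -[X in _ %| _ - _ * X](comp_polyX g).
  rewrite -comp_polyM -comp_polyB -exprS.
  apply: (dvdp_trans pbg); apply: dvdp_comp_poly.
  by rewrite dvdp_modpB subrr.
- move=> u _; rewrite mulrAC -mulrBl mulrC dvdp_mul2r //.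
  by rewrite dvdp_modpB subrr.
move=> u w su sw dv.
have dp : p %| p * p ^+ b by apply: dvdp_mulr.
have u0 : u = 0.
  apply: (small_dvdp0 su) => //; rewrite -[u]comp_polyXr.
  have := dvdp_trans dp dv; rewrite dvdp_addl ?dvdp_mulIr //.
  rewrite -[in X in X -> _](subrK (u \Po 'X) (u \Po g)) dvdp_addr //.
  exact: dvdp_trans pg (dvdp_compB _ _ _).
split=> //; apply: (small_dvdp0 sw); rewrite ?expf_neq0 //.
by move: dv; rewrite u0 comp_poly0 add0r mulrC dvdp_mul2r.
Qed.

Lemma bsim_nseq p g b L : p != 0 -> p %| g - 'X -> p ^+ b.+1 %| p \Po g ->
  bsim (nseq b.+1 (p, 'X) ++ L) ((p ^+ b.+1, g) :: L).
Proof.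
move=> p0 pg; elim: b => [|b IH] pb.
  apply: bsim_cons1; rewrite /= expr1 (mulmod_congr _ pg); exact: hsim_refl.
apply: bsim_trans (bsim_split _ p0 pg pb); apply/bsim_cons/IH.
by apply: dvdp_trans pb; rewrite dvdp_exp2l.
Qed.

(** Jordan blocks of sizes 2 and 1 with the same eigenvalue [c] make up the
    operator [c + Z^2] on [F[Y]/(Z^3)], where [Z = Y - c]: its square-zero part
    [Z^2] sends [1] to [Z^2] and kills [Z]. *)
Lemma bsim_jordan21 c L (Z : {poly F} := 'X - c%:P) :
  bsim ((Z ^+ 2, 'X) :: (Z, 'X) :: L) ((Z ^+ 3, c%:P + Z ^+ 2) :: L).
Proof.
apply: bsim_cons2 => /=.
have Z0 : Z != 0 by rewrite polyXsubC_eq0.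
have sZ3 : (size (Z ^+ 3)).-1 = ((size (Z ^+ 2)).-1 + (size Z).-1)%N.
  by rewrite !size_exp_XsubC size_XsubC.
rewrite sZ3.
apply: (@mulmod_block _ _ _ _ _ _ _ _
  (fun u => u \Po (c%:P + Z ^+ 2)) (fun u => u * Z)).
- by rewrite -sZ3 -size_predK // expf_neq0.
- by apply: size_predK; rewrite expf_neq0.
- exact: size_predK.
- exact: linear_comp.
- exact: linear_mulr.
- move=> u _; set g := c%:P + _; rewrite -[X in _ %| _ - _ * X](comp_polyX g).
  rewrite -comp_polyM -comp_polyB.
  apply: (@dvdp_trans _ ((Z ^+ 2) \Po g)).
    have -> : Z ^+ 2 \Po g = Z ^+ 4.
      by rewrite expr2 comp_polyM comp_polyB comp_polyX comp_polyC /g; ring.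
    by rewrite dvdp_exp2l.
  by apply: dvdp_comp_poly; rewrite dvdp_modpB subrr.
- move=> u; rewrite size_XsubC => /size1_polyC ->; set k := u`_0.
  rewrite modp_XsubC hornerM hornerC hornerX -mulrAC.
  have -> : (k * c)%:P * Z - k%:P * (c%:P + Z ^+ 2) * Z = - k%:P * Z ^+ 3.
    by rewrite polyCM; ring.
  exact: dvdp_mulIr.
rewrite size_exp_XsubC size_XsubC => u w su /size1_polyC -> dv.
move: w`_0 => k in dv *.
have uc : root u c.
  have ZZ3 : Z %| Z ^+ 3 by rewrite exprSr dvdp_mulIr.
  have := dvdp_trans ZZ3 dv; rewrite dvdp_addl ?dvdp_mulIr //.
  rewrite -root_factor_theorem /root /= horner_comp.
  by rewrite !hornerE subrr expr0n addr0.
have [q eq_u] := factor_theorem _ _ uc; rewrite -/Z in eq_u.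
have sq : (size q <= 1)%N.
  have [->|q0] := eqVneq q 0; first by rewrite size_poly0.
  by move: su; rewrite eq_u size_Mmonic ?monicXsubC // size_XsubC addn2 /=.
move: dv; rewrite eq_u (size1_polyC sq); move: q`_0 => b.
have -> : ((b%:P * Z) \Po (c%:P + Z ^+ 2)) + k%:P * Z = (b%:P * Z + k%:P) * Z.
  rewrite comp_polyM comp_polyB comp_polyX !comp_polyC; ring.
rewrite exprSr dvdp_mul2r // => dv.
have e : b%:P * Z + k%:P = 0.
  apply: small_dvdp0 dv; last by rewrite expf_neq0.
  rewrite size_exp_XsubC mul_polyC (leq_trans (size_polyD _ _)) // geq_max.
  rewrite (leq_trans (size_scale_leq _ _)) ?size_XsubC //.
  exact: leq_trans (size_polyC_leq1 _) _.
have k0 : k = 0.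
  by have := congr1 (horner^~ c) e; rewrite /= !hornerE subrr mulr0 add0r.
move: e; rewrite k0 addr0 => /eqP; rewrite mulf_eq0 (negPf Z0) orbF => /eqP ->.
by rewrite mul0r.
Qed.

(** * Primary decomposition *)

(** Let [p^(e+1) r] be the minimal polynomial of [A], with [r] prime to [p].
    There are a row [v] and a column [phi], both killed by [h = p^(e+1)], such
    that [v p^e(A) phi] is not 0. Since [p^e] generates the socle of
    [F[X]/(h)], the pairing of the cyclic space generated by [v] with the one
    generated by [phi] is then nondegenerate. The former is a copy of
    [F[X]/(h)], and the orthogonal of the latter is an [A]-stable complement. *)
Lemma split_primary n (A : 'M[F]_n.+1) :
  exists p e k (A2 : 'M_k), [/\ p \is monic, irreducible_poly p & hsim A
    (block_mx (mulmod_mx (size (p ^+ e.+1)).-1 (p ^+ e.+1) 'X) 0 0 A2)].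
Proof.
pose hA : {poly F} -> 'M[F]_n.+1 := horner_mx A.
have hAM x y : hA (x * y) = hA x *m hA y by rewrite /hA rmorphM.
have hAD x y : hA (x + y) = hA x + hA y by rewrite /hA rmorphD.
have hAZ a x : hA (a *: x) = a *: hA x by rewrite /hA linearZ.
have smp : (1 < size (mxminpoly A))%N.
  by rewrite size_mxminpoly ltnS mxminpoly_nonconstant.
have mp0 : mxminpoly A != 0 by rewrite -size_poly_gt0 ltnW.
have [p [pm irr pmp]] := exists_irreducible_factor smp.
have [e [r [emp pr]]] := factor_out irr.1 mp0.
case: e emp => [|e] emp.
  by case/negP: pr; move: pmp; rewrite emp expr0 mul1r.
have p0 := irredp_neq0 irr.
have r0 : r != 0 by apply: contraNneq pr => ->; apply: dvdp0.
(* By minimality [p^e r^2] does not kill [A]; a nonzero entry gives [v] and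
   [phi]. *)
have /matrix0Pn[i [j Dij]] : hA (r * p ^+ e * r) != 0.
  by rewrite -dvd_mxminpoly emp exprS -!mulrA dvdp_mul2r ?mulf_neq0 ?expf_neq0.
pose h : {poly F} := p ^+ e.+1; exists p, e; rewrite -/h.
pose v := delta_mx 0 i *m hA r : 'rV_n.+1.
pose phi := hA r *m delta_mx j 0 : 'cV_n.+1.
have mpA : hA (mxminpoly A) = 0 by apply: mx_root_minpoly.
have vh : v *m hA h = 0.
  by rewrite -mulmxA -hAM mulrC -emp mpA mulmx0.
have hphi : hA h *m phi = 0 by rewrite mulmxA -hAM -emp mpA mul0mx.
have vphi : v *m hA (p ^+ e) *m phi != 0.
  apply: contraNneq Dij; rewrite /v /phi !mulmxA -!(mulmxA (delta_mx 0 i)).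
  rewrite -!hAM => /matrixP/(_ 0 0); rewrite -rowE -colE !mxE => -> //.
clearbody v phi.
have hm : h \is monic by rewrite monic_exp.
have h0 := monic_neq0 hm.
set d := (size h).-1.
(* [P] maps [u] to [v u(A)]; the columns of [Q] are the [A^j phi], [j < d]. *)
pose P : 'M_(d, n.+1) := lin1_mx (fun u => v *m hA (rVpoly u)).
have PE (u : 'rV_d) : u *m P = v *m hA (rVpoly u).
  apply: (mul_rV_lin1_prop u (f := fun u => v *m hA (rVpoly u))) => a x y.
  by rewrite linearP hAD hAZ mulmxDr -scalemxAr.
pose Q : 'M_(n.+1, d) := \matrix_(i < n.+1, j < d) (hA 'X^j *m phi) i 0.
have QE (x : 'rV_n.+1) (l : 'I_d) : (x *m Q) 0 l = (x *m (hA 'X^l *m phi)) 0 0.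
  by rewrite !mxE; apply: eq_bigr => l' _; rewrite mxE.
(* As [h(A) phi = 0], being orthogonal to these columns is enough. *)
have Qall (x : 'rV_n.+1) s : x *m Q = 0 -> x *m (hA s *m phi) = 0.
  move=> xQ; rewrite (divp_eq s h) hAD mulmxDl mulmxDr.
  rewrite hAM -(mulmxA _ (hA h)) hphi !mulmx0 add0r.
  have : (size (s %% h)%R <= d)%N by rewrite -ltnS -size_predK // ltn_modp.
  move: (s %% h) => t st; rewrite -(poly_rV_K st) /rVpoly poly_def.
  rewrite (big_morph hA hAD (raddf0 _)) mulmx_suml mulmx_sumr big1 // => l _.
  rewrite hAZ -scalemxAl -scalemxAr; apply/matrixP => a b.
  by rewrite !ord1 mxE -QE xQ !mxE mulr0.
(* Nondegeneracy of the pairing. *)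
have PQ : row_free (P *m Q).
  apply: inj_row_free => u; rewrite mulmxA PE => /Qall uP.
  apply: contraTeq isT => u0.
  have U0 : rVpoly u != 0.
    by apply: contraNneq u0 => U0; rewrite -[u]rVpolyK U0 linear0.
  have [|s] := socle_primary (e := e) irr U0.
    by apply: contra U0 => dv; apply/eqP/(small_dvdp0 _ h0 dv)/size_poly.
  move/dvdpP => [t et]; case/negP: vphi; apply/eqP.
  have -> : p ^+ e = rVpoly u * s + h * - t.
    by rewrite mulrN (mulrC h) -et opprB addrCA subrr addr0.
  rewrite hAD !hAM mulmxDr mulmxDl -!mulmxA (mulmxA v (hA h)) vh mul0mx addr0.
  by rewrite (mulmxA v) uP.
have PX : mulmod_mx d h 'X *m P = P *m A.
  apply/row_matrixP => l; rewrite !row_mul [row l (mulmod_mx _ _ _)]rowE.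
  rewrite mul_mulmod PE poly_rV_K; last first.
    by rewrite -ltnS -size_predK // ltn_modp.
  rewrite rowE PE -mulmxA -[X in _ = _ *m (_ *m X)](horner_mx_X A) -/hA -hAM.
  rewrite [in RHS](divp_eq (rVpoly _ * 'X) h) hAD.
  by rewrite mulmxDr (mulrC _ h) hAM mulmxA vh mul0mx add0r.
pose K := row_base (kermx Q).
have KQ : K *m Q = 0 by apply/sub_kermxP; rewrite eq_row_base.
have KA : (K *m A <= K)%MS.
  rewrite eq_row_base; apply/sub_kermxP/row_matrixP => l.
  rewrite (row_mul l (K *m A)) (row_mul l K) row0.
  apply/rowP => b; rewrite QE [RHS]mxE -(mulmxA (row l K)) (mulmxA A).
  rewrite -[X in X *m hA _](horner_mx_X A) -/hA -hAM Qall ?mxE //.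
  by rewrite -row_mul KQ row0.
exists (\rank (kermx Q)), (K *m A *m pinvmx K); split=> //.
apply/hsim_sym/(@hsim_rect _ _ _ _ (col_mx P K)).
- have rQ : \rank Q = d.
    apply/eqP; rewrite eqn_leq rank_leq_col.
    by rewrite -{1}(eqP PQ) mxrankM_maxr.
  by rewrite mxrank_ker rQ subnKC // -rQ rank_leq_row.
- apply: inj_row_free => u; rewrite -[u]hsubmxK mul_row_col => e0.
  have l0 : lsubmx u = 0.
    apply: (row_free_inj PQ); rewrite mul0mx mulmxA.
    have := congr1 (mulmx^~ Q) e0.
    by rewrite mulmxDl mul0mx -(mulmxA _ K Q) KQ mulmx0 addr0.
  move: e0; rewrite l0 mul0mx add0r => e0.
  suff -> : rsubmx u = 0 by rewrite row_mx0.
  by apply: (row_free_inj (row_base_free (kermx Q))); rewrite mul0mx.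
- by rewrite mul_block_col !mul0mx addr0 add0r PX mulmxKpV // mul_col_mx.
Qed.

(** The pair [(p, e)] stands for the prime power [p^e], where
    [e > 0] and [p] is monic irreducible. *)
Definition primary (b : {poly F} * nat) :=
  [/\ b.1 \is monic, irreducible_poly b.1 & (0 < b.2)%N].

Lemma primary_decomposition n (A : 'M[F]_n) :
  exists2 L : seq ({poly F} * nat), (forall b, b \in L -> primary b) &
    hsim A (blocks_mx [seq (b.1 ^+ b.2, 'X) | b <- L]).
Proof.
have [m] := ubnP n; elim: m n A => // m IH [|n] A /ltnSE le_nm.
  by exists [::] => //; rewrite [A]flatmx0; apply: hsim_refl.
have [p [e [k [A2 [pm irr hA]]]]] := split_primary A.
have sp : (1 < size (p ^+ e.+1))%N.
  by rewrite -subn_gt0 subn1 size_exp muln_gt0 andbT -subn1 subn_gt0 irr.1.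
have [|L HL hA2] := IH k A2.
  have := hsim_dim hA; lia.
exists ((p, e.+1) :: L).
  by move=> b; rewrite inE => /predU1P[-> | /HL //].
apply: hsim_trans hA _; exact: hsim_block (hsim_refl _) hA2.
Qed.

(** * Merging blocks into one *)

(** All monic irreducible factors of [f] are in [ps], stated through
    coprimality. *)
Definition coprime_outside (ps : seq {poly F}) f :=
  forall r, r \is monic -> irreducible_poly r -> r \notin ps -> coprimep r f.

(** The triples [((p, e), g)] stand for the blocks [(p^e, g)]. When few enough
    of the [p] have each given degree, shifts chosen one after the other make
    them pairwise distinct, and the blocks merge into one. The list [ps] of the
    shifted [p] is recorded with its degrees for the induction. *)
Lemma bsim_greedy (s : seq F) (L : seq ({poly F} * nat * {poly F})) :
    uniq s -> (forall b, b \in L -> primary b.1) ->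
    (forall d, (0 < d)%N ->
       (d * count (fun b : {poly F} * nat * {poly F} => size b.1.1 == d.+1) L
          < size s + d)%N) ->
  exists f g ps, [/\ f \is monic,
    bsim [seq (b.1.1 ^+ b.1.2, b.2) | b <- L] [:: (f, g)],
    map (fun p : {poly F} => size p) ps =
      map (fun b : {poly F} * nat * {poly F} => size b.1.1) L &
    coprime_outside ps f].
Proof.
move=> us; elim: L => [|[[p e] u] L IH] HL cL.
  exists 1, 0, [::]; split; [exact: monic1 | exact: bsim_nil | by [] | ].
  by move=> r _ _ _; apply: coprimep1.
have [/= pm pirr e0] := HL _ (mem_head _ _).
have [||f [g [ps [fm fg eps fco]]]] := IH.
- by move=> b bL; apply: HL; rewrite inE bL orbT.
- move=> d d0; apply: leq_ltn_trans (cL d d0).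
  by rewrite leq_pmul2l //= leq_addl.
have p0 := monic_neq0 pm; have sp := pirr.1.
have [|c cps] := @exists_shift s p ps sp us.
  have := cL (size p).-1; rewrite /= -size_predK // eqxx.
  have -> : count (fun r : {poly F} => size r == size p) ps =
    count (fun b : {poly F} * nat * {poly F} => size b.1.1 == size p) L.
    by rewrite -(count_map _ (pred1 (size p))) eps count_map.
  by rewrite mulnDr muln1 addnC ltn_add2r; apply; rewrite -subn1 subn_gt0.
pose q := p \Po ('X - c%:P).
have qm : q \is monic by apply: monic_shift.
have qirr : irreducible_poly q by apply: irredp_shift.
have qe0 : q ^+ e != 0 by rewrite expf_neq0 // monic_neq0.
have cop : coprimep (q ^+ e) f by apply/coprimep_expl/fco.
have [w [wu wg]] := chinese_poly (u \Po ('X - c%:P)) g cop.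
exists (q ^+ e * f), w, (q :: ps); split.
- by rewrite monicMl // monic_exp.
- apply: bsim_trans (bsim_crt _ qe0 (monic_neq0 fm) cop wu wg).
  apply: bsim_trans (bsim_cons _ fg) _.
  have -> : q ^+ e = (p ^+ e) \Po ('X - c%:P).
    by rewrite /q rmorphXn.
  by apply: bsim_shift; rewrite expf_neq0.
- by rewrite /= eps size_comp_poly2 ?size_XsubC.
move=> r rm rirr; rewrite inE negb_or => /andP[rp rps].
rewrite coprimepMr fco // andbT coprimep_sym.
by apply/coprimep_expl/irredp_neq_coprime; rewrite // eq_sym.
Qed.

(** Equal separable blocks are merged into a power by [bsim_nseq], without any
    shift; no condition on the size of the field is required. *)
Lemma bsim_semisimple (ps : seq {poly F}) :
    (forall p, p \in ps ->
       [/\ p \is monic, irreducible_poly p & coprimep p p^`()]) ->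
  exists f g, [/\ f \is monic, bsim [seq (p, 'X) | p <- ps] [:: (f, g)] &
    coprime_outside ps f].
Proof.
have [n] := ubnP (size ps); elim: n ps => // n IH [|p ps] /ltnSE sps Hps.
  exists 1, 0; split; [exact: monic1 | exact: bsim_nil | ].
  by move=> r _ _ _; apply: coprimep1.
have [pm pirr psep] := Hps p (mem_head _ _).
have p0 := monic_neq0 pm.
pose qs := [seq q <- ps | q != p].
have [||f [g [fm fg fco]]] := IH qs.
- by apply: leq_ltn_trans sps; rewrite size_filter count_size.
- move=> q; rewrite mem_filter => /andP[_ qps].
  by apply: Hps; rewrite inE qps orbT.
have pqs : p \notin qs by rewrite mem_filter eqxx.
pose b := count_mem p ps.
have [u [uX pu]] := newton_root b.+1 psep.
have cop : coprimep (p ^+ b.+1) f by apply/coprimep_expl/fco.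
have [w [wu wg]] := chinese_poly u g cop.
have pb0 : p ^+ b.+1 != 0 by rewrite expf_neq0.
exists (p ^+ b.+1 * f), w; split.
- by rewrite monicMl // monic_exp.
- apply: bsim_trans (bsim_crt _ pb0 (monic_neq0 fm) cop wu wg).
  apply: bsim_trans (bsim_cons _ fg).
  apply: bsim_trans (bsim_nseq _ p0 uX pu); apply: bsim_perm.
  rewrite /= perm_cons /qs.
  have -> : nseq b (p, 'X) = [seq (q, 'X) | q <- ps & q == p]
      :> seq (_ * {poly F}).
    have /all_pred1P -> := filter_all (pred1 p) ps.
    by rewrite size_filter map_nseq.
  rewrite -map_cat perm_map // perm_sym.
  exact/permEl/(perm_filterC (pred1 p)).
move=> r rm rirr; rewrite inE negb_or => /andP[rp rps].
rewrite coprimepMr; apply/andP; split.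
  rewrite coprimep_sym; apply/coprimep_expl/irredp_neq_coprime => //.
  by rewrite eq_sym.
by apply: fco => //; rewrite mem_filter negb_and rps orbT.
Qed.

(** * Counting the blocks *)

Implicit Types L : seq ({poly F} * nat).

(** The dimension of the direct sum of the [F[X]/(p^e)], for [(p, e)] in [L]. *)
Definition weight (L : seq ({poly F} * nat)) : nat :=
  sumn [seq ((size b.1).-1 * b.2)%N | b : {poly F} * nat <- L].

(** The number of [(p, e)] in [L] with [deg p = d]. *)
Definition deg_count d (L : seq ({poly F} * nat)) : nat :=
  count (fun b : {poly F} * nat => size b.1 == d.+1) L.

Lemma blocks_dim_primary L :
  blocks_dim [seq (b.1 ^+ b.2, 'X) | b <- L] = weight L.
Proof. by elim: L => //= b L ->; rewrite size_exp. Qed.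

Lemma primary_cons (b : {poly F} * nat) L :
  (forall c, c \in b :: L -> primary c) ->
  primary b /\ (forall c, c \in L -> primary c).
Proof.
move=> H; split; first exact: H (mem_head _ _).
by move=> c cL; apply: H; rewrite inE cL orbT.
Qed.

Lemma deg_count_weight d L : (forall b, b \in L -> primary b) ->
  (d * deg_count d L <= weight L)%N.
Proof.
elim: L => [|b L IH] //; first by rewrite muln0.
move=> /primary_cons[[_ _ b2] /IH]; rewrite /deg_count /weight /=.
by case: eqP => [-> | _]; rewrite /=; nia.
Qed.

(** The equality case of [deg_count_weight]. *)
Lemma weight_deg_count d L : (0 < d)%N -> (forall b, b \in L -> primary b) ->
  (weight L <= d * deg_count d L)%N ->
  all (fun b : {poly F} * nat => (size b.1 == d.+1) && (b.2 == 1%N)) L.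
Proof.
move=> d0; elim: L => [|b L IH] // /primary_cons[[_ [sp _] b2] HL].
have := deg_count_weight d HL; rewrite /deg_count /weight /= in IH *.
case: eqP => [-> | _] /= le1 le2.
  have e1 : b.2 = 1%N by nia.
  by rewrite e1 eqxx /=; apply: IH => //; nia.
have w0 : (0 < (size b.1).-1 * b.2)%N.
  by rewrite muln_gt0 b2 andbT -subn1 subn_gt0.
by move: (leq_trans le2 le1); rewrite -[leqRHS]add0n leq_add2r leqNgt w0.
Qed.

(** If all but at most one of the dimensions are accounted for by counting the
    linear blocks once each, the only possible excess is a single [p^2] with [p]
    linear. *)
Lemma weight_excess L : (forall b, b \in L -> primary b) ->
    (weight L <= (deg_count 1 L).+1)%N ->
    all (fun b : {poly F} * nat => (size b.1 == 2%N) && (b.2 == 1%N)) L \/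
  exists p (ps : seq {poly F}),
    [/\ size p = 2%N, forall q, q \in ps -> size q = 2%N &
      perm_eq L ((p, 2%N) :: [seq (q, 1%N) | q <- ps])].
Proof.
elim: L => [|[p e] L IH]; first by left.
move=> /primary_cons[[/= _ [sp _] e0] HL].
have := deg_count_weight 1 HL; rewrite /deg_count /weight /= in IH *.
have wL := @weight_deg_count 1 L isT HL.
rewrite /deg_count /weight /= in wL.
case: eqP => [sp2 | sp2] /= le1 le2; last first.
  have w2 : (2 <= (size p).-1 * e)%N.
    apply: (@leq_mul 2 1) => //.
    by case: (size p) sp sp2 => [|[|[]]].
  have aux w k x : (1 * k <= w)%N -> (x + w <= (0 + k).+1)%N ->
    (2 <= x)%N -> False by lia.
  by case: (aux _ _ _ le1 le2 w2).
rewrite sp2 in le2.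
have [e1 | e1] := eqVneq e 1%N.
  subst e; case: (IH HL) => [|/= allL|]; [lia | by left | ].
  move=> [q [qs [sq sqs pL]]]; right; exists q, (p :: qs); split=> //.
    by move=> r; rewrite inE => /predU1P[-> //|]; apply: sqs.
  rewrite -(perm_cons (p, 1%N)) in pL; apply: perm_trans pL _.
  by rewrite -(cat1s (q, 2%N)) -(cat1s (p, 1%N)) perm_catCA.
have e2 : e = 2%N by lia.
have allL : all (fun b : {poly F} * nat => (size b.1 == 2%N) && (b.2 == 1%N)) L.
  by apply: wL; lia.
right; exists p, [seq b.1 | b <- L]; split=> //.
  by move=> q /mapP[b /(allP allL) /andP[/eqP sb _] ->].
rewrite e2 perm_cons -map_comp -[X in perm_eq X]map_id.
have /eq_in_map -> : {in L, id =1 (fun q : {poly F} => (q, 1%N)) \o fst}.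
  by move=> [q k] /(allP allL) /= /andP[_ /eqP->].
exact: perm_refl.
Qed.

Lemma weight_linear (ps : seq {poly F}) :
  (forall q, q \in ps -> size q = 2%N) ->
  weight [seq (q, 1%N) | q <- ps] = size ps.
Proof.
elim: ps => [|q ps IH] //= Hps; rewrite /weight /= Hps ?mem_head //.
by rewrite -/(weight _) IH // => r rps; apply: Hps; rewrite inE rps orbT.
Qed.

(** The case distinction: the greedy choice of shifts, or else one of its three
    exceptions. *)
Lemma bsim_cyclic (s : seq F) (L : seq ({poly F} * nat)) :
    uniq s -> (forall b, b \in L -> primary b) -> (weight L <= (size s).+2)%N ->
  exists f g, f \is monic /\
    bsim [seq (b.1 ^+ b.2, 'X) | b <- L] [:: (f, g)].
Proof.
move=> us HL wL.
have greedy (t : seq F) : uniq t -> (weight L <= (size t).+2)%N ->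
    (deg_count 1 L <= size t)%N -> (2 * deg_count 2 L < (size t).+2)%N ->
  exists f g, f \is monic /\
    bsim [seq (b.1 ^+ b.2, 'X) | b <- L] [:: (f, g)].
  move=> ut wt k1 k2.
  have [||f [g [ps [fm fg _ _]]]] :=
    bsim_greedy (L := [seq (b, 'X) | b <- L]) ut.
  - by move=> _ /mapP[b bL ->]; apply: HL.
  - move=> d d0; rewrite count_map -/(deg_count d L).
    by have := deg_count_weight d HL; case: d d0 => [|[|[|d]]] // _; lia.
  by exists f, g; split=> //; move: fg; rewrite -map_comp.
(* All exponents 1 and all [p] separable: no shifts. *)
have [ss | nss] := boolP (all (fun b : {poly F} * nat =>
    (b.2 == 1%N) && coprimep b.1 b.1^`()) L).
  have [|f [g [fm fg _]]] := @bsim_semisimple [seq b.1 | b <- L].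
    move=> _ /mapP[b bL ->]; have [bm birr _] := HL _ bL.
    by split=> //; have /andP[] := allP ss _ bL.
  exists f, g; split=> //; move: fg; rewrite -map_comp.
  have /eq_in_map -> // : {in L,
      (fun p : {poly F} => (p, 'X : {poly F})) \o fst =1
      (fun b => (b.1 ^+ b.2, 'X))}.
  by move=> b /(allP ss) /andP[/eqP /= -> _]; rewrite expr1.
(* Too many linear blocks: a square of a linear polynomial, the rest simple. *)
have [k1 | k1] := leqP (deg_count 1 L) (size s); last first.
  case: (weight_excess HL) => [|allL|]; first by lia.
    case/negP: nss; apply/allP => b bL; have [bm _ _] := HL b bL.
    by have /andP[/eqP sb ->] := allP allL _ bL; rewrite size2_separable.
  move=> [p [ps [sp sps pL]]].
  have Hps q : q \in ps ->
    [/\ q \is monic, irreducible_poly q & coprimep q q^`()].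
    move=> qps; have [|/= qm qirr _] := HL (q, 1%N).
      by rewrite (perm_mem pL) inE map_f ?orbT.
    by split=> //; apply: size2_separable (sps _ qps).
  have [|/= pm pirr _] := HL (p, 2%N); first by rewrite (perm_mem pL) mem_head.
  have simL : bsim [seq (b.1 ^+ b.2, 'X) | b <- L]
      ((p ^+ 2, 'X) :: [seq (q, 'X) | q <- ps]).
    apply: bsim_trans (bsim_perm (perm_map _ pL)) _; rewrite /= -map_comp.
    rewrite (eq_map (g := fun q => (q, 'X))) => [|q /=]; last by rewrite expr1.
    exact: bsim_refl.
  have wps : (size ps <= size s)%N.
    have eps := weight_linear sps; move: wL.
    rewrite /weight (perm_sumn (perm_map _ pL)) /= sp -/(weight _) eps; lia.
  have [pps | pps] := boolP (p \in ps).
    have [c pc] := size2_monicE pm sp.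
    pose M := (p, 3%N, c%:P + p ^+ 2) :: [seq (q, 1%N, 'X) | q <- rem p ps].
    have [||f [g [qs [fm fg _ _]]]] := bsim_greedy (L := M) us.
    - move=> b; rewrite inE => /predU1P[-> //|].
      by move=> /mapP[q /mem_rem /Hps[qm qi _] ->].
    - move=> d d0.
      rewrite (@eq_in_count _ _ (fun=> 2%N == d.+1)) => [|b]; last first.
        rewrite inE => /predU1P[-> /= | /mapP[q /mem_rem /sps sq ->]].
          by rewrite sp.
        by rewrite /= sq.
      case: eqP => [[<-] | _]; last first.
        by rewrite count_pred0 muln0 addn_gt0 d0 orbT.
      rewrite count_predT /= size_map size_rem // prednK ?mul1n ?addn1 //.
      by case: (ps) pps.
    exists f, g; split=> //; apply: bsim_trans simL _; apply: bsim_trans fg.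
    apply: (@bsim_trans _
      ((p ^+ 2, 'X) :: (p, 'X) :: [seq (q, 'X) | q <- rem p ps])).
      apply/bsim_cons/bsim_perm.
      exact: (perm_map (fun q => (q, 'X)) (perm_to_rem pps)).
    rewrite /= -map_comp (@eq_map _ _ _ (fun q => (q, 'X))) => [|q /=].
      by rewrite pc; apply: bsim_jordan21.
    by rewrite expr1.
  have [f [g [fm fg fco]]] := bsim_semisimple Hps.
  have cop : coprimep (p ^+ 2) f by apply/coprimep_expl/fco.
  have p20 : p ^+ 2 != 0 by rewrite expf_neq0 // monic_neq0.
  have [w [wp wf]] := chinese_poly 'X g cop.
  exists (p ^+ 2 * f), w; split; first by rewrite monicMl // monic_exp.
  apply: bsim_trans simL _.
  apply: bsim_trans (bsim_crt _ p20 (monic_neq0 fm) cop wp wf).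
  exact: bsim_cons.
(* Too many quadratic blocks: they fill the whole dimension, and one of them is
   inseparable, which provides one more scalar. *)
have [k2 | k2] := ltnP (2 * deg_count 2 L) (size s).+2; first exact: (greedy s).
have allL := @weight_deg_count 2 L isT HL.
have [x xs] : exists x, x \notin s.
  have /allPn[b bL] := nss.
  have [bm birr _] := HL b bL.
  have /andP[/eqP sb /eqP b1] := allP (allL (leq_trans wL k2)) b bL.
  rewrite b1 eqxx /= => nsep; exact: (inseparable_quadratic bm birr sb nsep us).
have dw := deg_count_weight 2 HL.
by apply: (greedy (x :: s)); rewrite /= ?xs //; lia.
Qed.

(** * Companion matrices *)

Lemma mulmodX_companion n f : f \is monic -> size f = n.+2 ->
  mulmod_mx n.+1 f 'X = (companion n.+1 f)^T.
Proof.
move=> fm sf; apply/row_matrixP => i; rewrite rowE mul_mulmod rVpoly_delta.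
apply/rowP => j; rewrite -exprSr !mxE.
case: eqP => [-> | /eqP ni]; last first.
  rewrite modp_small ?coefXn // size_polyXn sf !ltnS ltn_neqAle ni.
  exact: (ltn_ord i).
rewrite /=.
have -> : 'X^(n.+1) = 1 * f + ('X^(n.+1) - f) :> {poly F}.
  by rewrite mul1r addrC subrK.
rewrite modpD modp_mull add0r modp_small ?coefB ?coefXn.
  by rewrite ltn_eqF ?sub0r // ltn_ord.
rewrite sf ltnS; apply/leq_sizeP => k.
rewrite leq_eqVlt coefB coefXn => /predU1P[<-|lk].
  by have := monicP fm; rewrite /lead_coef sf eqxx /= => ->; rewrite subrr.
by rewrite gtn_eqF // nth_default ?sf // subrr.
Qed.

Lemma horner_mulmodX n f g : size f = n.+2 ->
  horner_mx (mulmod_mx n.+1 f 'X) g = mulmod_mx n.+1 f g.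
Proof.
move=> sf; have f0 : f != 0 by rewrite -size_poly_gt0 sf.
have smod q : (size (q %% f)%R <= n.+1)%N by rewrite -ltnS -sf ltn_modp.
elim/poly_ind: g => [|g c IH].
  apply/row_matrixP => i.
  by rewrite rmorph0 row0 rowE mul_mulmod mulr0 mod0p linear0.
rewrite rmorphD rmorphM /= horner_mx_X horner_mx_C IH.
apply/row_matrixP => i; rewrite linearD /= row_mul !rowE !mul_mulmod.
rewrite poly_rV_K // mulrC modp_mul mul_mx_scalar mulrDr modpD linearD /=.
rewrite mulrC -mulrA; congr (_ + _).
rewrite mulrC mul_polyC modpZl linearZ /= modp_small ?rVpolyK //.
by rewrite sf ltnS size_poly.
Qed.

Lemma horner_mx_tr n (C : 'M[F]_n.+1) g : (horner_mx C g)^T = horner_mx C^T g.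
Proof.
elim/poly_ind: g => [|g c IH]; first by rewrite !rmorph0 trmx0.
rewrite !rmorphD !rmorphM /= !horner_mx_X !horner_mx_C linearD /= tr_scalar_mx.
by rewrite trmx_mul IH; congr (_ + _); apply: comm_mx_horner.
Qed.

(** Transposition turns the row convention of [mulmod_mx] into the column
    convention of [companion]. *)
Lemma hsim_companion n (A : 'M[F]_n.+1) f g :
    f \is monic -> hsim A^T (blocks_mx [:: (f, g)]) ->
  size f = n.+2 /\ A ~_{in unitmx} (horner_mx (companion n.+1 f) g).
Proof.
move=> fm /hsim_trans/(_ (blocks_mx1 _)) /= h.
have sf : size f = n.+2 by rewrite (size_predK (monic_neq0 fm)) -(hsim_dim h).
rewrite sf /= in h; split=> //; case: h => P [Q [PQ QP AP]].
have uP : P \in unitmx by case: (mulmx1_unit PQ).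
exists P^T; first by rewrite unitmx_tr.
apply/simmxP; first by rewrite unitmx_tr.
rewrite -[A]trmxK -trmx_mul AP trmx_mul -horner_mulmodX //.
by rewrite mulmodX_companion // horner_mx_tr trmxK.
Qed.

End Blocks.

Theorem theorem3p8 (n : nat) (F : fieldType)
    (hF : at_least_elements (n.+1 - 2) F) (A : 'M[F]_n.+1) :
  exists f g : {poly F},
    [/\ f \is monic, size f = n.+2 &
        A ~_{in unitmx} (horner_mx (companion n.+1 f) g)].
Proof.
have [s us ls] := hF.
have [L HL hA] := primary_decomposition A^T.
have wL : (weight L <= (size s).+2)%N.
  by rewrite -blocks_dim_primary -(hsim_dim hA); lia.
have [f [g [fm fg]]] := bsim_cyclic us HL wL.
by exists f, g; have [sf sim] := hsim_companion fm (hsim_trans hA fg).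
Qed.
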